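(* Let $p\in[2,\infty)$ and let $A,B,D\in M_n(\mathbb{C})$. Then: (1) $$w_p\left(\begin{bmatrix}A&0\\0&D\end{bmatrix}\right)\le\frac{1}{2^{\frac2p-1}}\Big(w_p^p(A)+w_p^p(D)\Big)^{1/p},$$ and if $A$ and $D$ are Hermitian, then $$w_p\left(\begin{bmatrix}A&0\\0&D\end{bmatrix}\right)=\Big(w_p^p(A)+w_p^p(D)\Big)^{1/p}.$$ (2) $$w_p\left(\begin{bmatrix}A&B\\0&0\end{bmatrix}\right)\le\frac{1}{2^{\frac2p-1}}\Big(w_p^p(A)+\frac{1}{2^{p-1}}\|B\|_p^p\Big)^{1/p}.$$
   Context: For $p\in[1,\infty)$, $\|\cdot\|_p$ denotes the Schatten $p$-norm on $M_m(\mathbb{C})$, $\|Y\|_p=(\sum_j s_j(Y)^p)^{1/p}$ with $s_j(Y)$ the singular values of $Y$. The Schatten $p$-generalized numerical radius is $w_p(Y)=\sup_{\theta\in\mathbb{R}}\|\mathrm{Re}(e^{i\theta}Y)\|_p$, where $\mathrm{Re}(Z)=\frac12(Z+Z^* )$. The notation $w_p^p(Y)$ means $(w_p(Y))^p$. Block matrices are elements of $M_{2n}(\mathbb{C})$ with $n\times n$ blocks. *)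

(* Defs.v *)
From mathcomp Require Import all_boot all_order all_algebra.
From mathcomp Require Import complex.
From mathcomp Require Import all_classical all_reals all_analysis.

Set Implicit Arguments.
Unset Strict Implicit.
Unset Printing Implicit Defensive.

Import Order.TTheory GRing.Theory Num.Theory.

Local Open Scope ring_scope.
Local Open Scope sesquilinear_scope.
Local Open Scope complex_scope.
Local Open Scope classical_set_scope.

(* The square roots of the eigenvalues, with multiplicity, of the Hermitian
   matrix Y^* Y.  These eigenvalues are nonnegative reals stored in R[i], so
   taking the real part only moves them to R.  They are not sorted. *)
Definition singular_value (R : realType) (m : nat) (Y : 'M[R[i]]_m)
    (j : 'I_m) : R :=
  Num.sqrt (complex.Re (spectral_diag (Y ^t* *m Y) 0 j)).

Definition schatten_norm (R : realType) (m : nat) (p : R)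
    (Y : 'M[R[i]]_m) : R :=
  (\sum_(j < m) singular_value Y j `^ p) `^ p^-1.

Definition re_mx (R : realType) (m : nat) (Z : 'M[R[i]]_m) : 'M[R[i]]_m :=
  2^-1 *: (Z + Z ^t*).

Definition expi (R : realType) (theta : R) : R[i] := cos theta +i* sin theta.

(* The set is nonempty and, for 1 <= p, bounded, so the real-valued sup is a
   genuine least upper bound. *)
Definition schatten_numrad (R : realType) (m : nat) (p : R)
    (Y : 'M[R[i]]_m) : R :=
  sup [set schatten_norm p (re_mx (expi theta *: Y)) | theta in [set: R]].

(* Main.v *)
(* For a Hermitian matrix the p-th power of the Schatten norm is the sum of the
   p-th powers of the absolute eigenvalues.  The real part of a block diagonal
   matrix is block diagonal, so (1) already holds with constant 1, and
   1 <= 2 ^ (1 - 2 / p); for Hermitian blocks the supremum is attained at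
   theta = 0.  For (2) the real part is M = [H, K; K^*, 0] with H = Re (e A) and
   K = e B / 2.  Peierls' inequality gives convexity of the trace of |S|^r, and
   applying it with r = p / 2 to M M^* bounds ||M||_p^p by
   2 ^ (p - 2) (||H||_p^p + 2 ||K||_p^p). *)
Require Import Defs.
From mathcomp Require Import all_boot all_order all_algebra.
From mathcomp Require Import complex.
From mathcomp Require Import ring lra.
From mathcomp Require Import all_classical all_reals all_analysis.

Set Implicit Arguments.
Unset Strict Implicit.
Unset Printing Implicit Defensive.

Import Order.TTheory GRing.Theory Num.Theory.

Local Open Scope ring_scope.

Section CharPoly.
Variable F : fieldType.

Lemma char_poly_mulC m (X Y : 'M[F]_m) :
  char_poly (X *m Y) = char_poly (Y *m X).
Proof.
pose x := 'X%:M : 'M[{poly F}]_m.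
pose X' := map_mx polyC X; pose Y' := map_mx polyC Y.
pose W := block_mx x X' Y' 1%:M.
have W1 : W *m block_mx 1%:M 0 (- Y') 1%:M = block_mx (x - X' *m Y') X' 0 1%:M.
  by rewrite mulmx_block !mulmx1 !mulmx0 !mulmxN !add0r mul1mx subrr.
have W2 : W *m block_mx 1%:M (- X') 0 x = block_mx x 0 Y' (x - Y' *m X').
  rewrite mulmx_block !mulmx1 !mulmx0 !mulmxN !addr0 mul1mx /x scalar_mxC.
  by rewrite [- _ + _]addrC subrr [- _ + _]addrC.
have [/(congr1 determinant) D1 /(congr1 determinant) D2] := (W1, W2).
move: D1 D2; rewrite !det_mulmx !(det_ublock, det_lblock) !det1 !mulr1 !mul1r.
move=> -> /eqP.
rewrite mulrC /x det_scalar (inj_eq (mulfI _)) ?expf_neq0 ?polyX_eq0 // => /eqP.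
by rewrite /char_poly /char_poly_mx !map_mxM.
Qed.

Lemma char_poly_diag m (d : 'rV[F]_m) :
  char_poly (diag_mx d) = \prod_j ('X - (d 0 j)%:P).
Proof.
rewrite char_poly_trig ?diag_mx_is_trig //.
by apply: eq_bigr => j _; rewrite mxE eqxx.
Qed.

Lemma char_poly_block_diag m n (A : 'M[F]_m) (B : 'M[F]_n) :
  char_poly (block_mx A 0 0 B) = char_poly A * char_poly B.
Proof. by rewrite /char_poly char_block_diag_mx det_ublock. Qed.

End CharPoly.

Section RealPowers.
Variable R : realType.
Implicit Types r : R.

Lemma powR_jensen (I : finType) r (q a : I -> R) : 1 <= r ->
  (forall i, 0 <= q i) -> \sum_i q i = 1 -> (forall i, 0 <= a i) ->
  (\sum_i q i * a i) `^ r <= \sum_i q i * a i `^ r.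
Proof.
move=> r1 q0 q1 a0; set m := \sum_i q i * a i.
have m0 : 0 <= m by apply: sumr_ge0 => i _; rewrite mulr_ge0.
have r0 : 0 < r by rewrite (lt_le_trans _ r1).
have [r_eq1|rn1] := eqVneq r 1.
  rewrite r_eq1 powRr1 //; apply: ler_sum => i _.
  by rewrite powRr1.
have {rn1}r1 : 1 < r by rewrite lt_neqAle eq_sym rn1.
(* Sum Young's inequality for a i and m^(r-1). *)
pose s := r / (r - 1).
have s0 : 0 < s by rewrite divr_gt0 // subr_gt0.
have rs : r^-1 + s^-1 = 1.
  by rewrite /s invf_div -{1}(div1r r) -mulrDl subrKC mulfV // gt_eqF.
have ms : (m `^ (r - 1)) `^ s = m `^ r.
  by rewrite -powRrM /s mulrCA mulfV ?mulr1 // subr_eq0 gt_eqF.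
have : m `^ r <= r^-1 * (\sum_i q i * a i `^ r) + s^-1 * m `^ r.
  have mq : m `^ r = \sum_i q i * m `^ r by rewrite -mulr_suml q1 mul1r.
  rewrite [in leRHS]mq -{1}mulr_powRB1 // mulr_suml !mulr_sumr -big_split /=.
  apply: ler_sum => i _.
  have := conjugate_powR (a0 i) (powR_ge0 m (r - 1)) r0 s0 rs.
  rewrite ms => /(ler_wpM2l (q0 i)) h; rewrite -mulrA; apply: (le_trans h).
  by rewrite le_eqVlt; apply/orP; left; apply/eqP; ring.
have -> : s^-1 = 1 - r^-1 by rewrite -rs; ring.
rewrite mulrBl mul1r => h; have {h} :
    r^-1 * m `^ r <= r^-1 * (\sum_i q i * a i `^ r) by lra.
by rewrite ler_pM2l // invr_gt0.
Qed.

Lemma powR_normD r (x y : R) : 1 <= r ->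
  `|x + y| `^ r <= 2 `^ (r - 1) * (`|x| `^ r + `|y| `^ r).
Proof.
move=> r1; have r0 : 0 < r by rewrite (lt_le_trans _ r1).
have := @powR_jensen bool r (fun=> 2^-1) (fun b => if b then `|x| else `|y|) r1.
rewrite !big_bool /=.
have h2 : 2 != 0 :> R by [].
have -> : 2^-1 * `|x| + 2^-1 * `|y| = 2^-1 * (`|x| + `|y|) by ring.
rewrite powRM ?addr_ge0 // -mulrDr => J.
have := ler_normD x y => /(ge0_ler_powR (ltW r0)) h.
apply: (le_trans (h _ _)); rewrite ?nnegrE ?addr_ge0 //.
have {}J : 2^-1 `^ r * (`|x| + `|y|) `^ r <= 2^-1 * (`|x| `^ r + `|y| `^ r).
  by apply: J => [_||[]] //; lra.
rewrite -ler_pdivrMl ?powR_gt0 // -powRN opprB.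
have -> : 2 `^ (1 - r) = 2 * 2^-1 `^ r :> R.
  rewrite powRD; last by apply/implyP.
  by rewrite powRr1 // -[in RHS]powR_inv1 // -powRrM mulN1r.
by rewrite -mulrA -ler_pdivlMl.
Qed.

Lemma norm_powR_le1 r (x : R) : 0 <= r -> `|x| <= 1 -> `|x| `^ r <= 1.
Proof.
move=> r0 x1; have <- : 1 `^ r = 1 :> R by rewrite powR1.
by apply: ge0_ler_powR; rewrite ?nnegrE.
Qed.

Lemma powRVK r (x : R) : r != 0 -> 0 <= x -> (x `^ r^-1) `^ r = x.
Proof. by move=> r0 x0; rewrite -powRrM mulVf // powRr1. Qed.

Lemma powRKV r (x : R) : r != 0 -> 0 <= x -> (x `^ r) `^ r^-1 = x.
Proof. by move=> r0 x0; rewrite -powRrM mulfV // powRr1. Qed.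

End RealPowers.

Section Conjugation.
Local Open Scope sesquilinear_scope.
Local Open Scope complex_scope.
Variable R : realType.
Local Notation C := R[i].

Lemma mulc_conj (z : C) :
  z * z^*%R = (complex.Re z ^+ 2 + complex.Im z ^+ 2)%:C.
Proof. by case: z => a b; rewrite /GRing.mul /=; congr (_ +i* _); ring. Qed.

Lemma conj_real_complex (a : R) : (a%:C)^*%R = a%:C.
Proof. exact: conjc_real. Qed.

Lemma ReMl (a : R) (z : C) : complex.Re (a%:C * z) = a * complex.Re z.
Proof. by case: z => x y; rewrite /= mul0r subr0. Qed.

Lemma adjmxE m n (A : 'M[C]_(m, n)) i j : (A ^t*) i j = (A j i)^*%R.
Proof. by rewrite !mxE. Qed.

Lemma adjmxM m n k (A : 'M[C]_(m, n)) (B : 'M[C]_(n, k)) :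
  (A *m B) ^t* = B ^t* *m A ^t*.
Proof. by rewrite trmx_mul map_mxM. Qed.

Lemma adjmxD m n (A B : 'M[C]_(m, n)) : (A + B) ^t* = A ^t* + B ^t*.
Proof. by rewrite linearD /= map_mxD. Qed.

Lemma adjmxZ m n a (A : 'M[C]_(m, n)) : (a *: A) ^t* = a^*%R *: A ^t*.
Proof. by rewrite linearZ /= map_mxZ. Qed.

Lemma adjmx_block m n k l (A : 'M[C]_(m, k)) (B : 'M[C]_(m, l))
    (D : 'M[C]_(n, k)) (E : 'M[C]_(n, l)) :
  (block_mx A B D E) ^t* = block_mx (A ^t*) (D ^t*) (B ^t*) (E ^t*).
Proof. by rewrite tr_block_mx map_block_mx. Qed.

Lemma adjmx0 m n : (0 : 'M[C]_(m, n)) ^t* = 0.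
Proof. by rewrite trmx0 map_mx0. Qed.

Lemma hermsymmxE m (A : 'M[C]_m) : (A \is hermsymmx) = (A ^t* == A).
Proof. by rewrite is_hermitianmxE expr0 scale1r eq_sym. Qed.

Lemma hermsymmx_normal m (A : 'M[C]_m) : A ^t* = A -> A \is normalmx.
Proof. by move=> h; apply/normalmxP; rewrite h. Qed.

Lemma gram_hermitian m n (Y : 'M[C]_(m, n)) :
  (Y ^t* *m Y) ^t* = Y ^t* *m Y.
Proof. by rewrite adjmxM trmxCK. Qed.

End Conjugation.

Section TracePow.
Local Open Scope sesquilinear_scope.
Local Open Scope complex_scope.
Variable R : realType.
Local Notation C := R[i].
Implicit Types r p : R.

(* For Hermitian [S] this is the trace of [|S|^r]; [spectral_diag] is junk when
   [S] is not normal. *)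
Definition trace_pow r m (S : 'M[C]_m) : R :=
  \sum_(j < m) `|complex.Re (spectral_diag S 0 j)| `^ r.

Lemma trace_pow_ge0 r m (S : 'M[C]_m) : 0 <= trace_pow r S.
Proof. by apply: sumr_ge0 => j _; exact: powR_ge0. Qed.

Lemma normal_spectral m (S : 'M[C]_m) : S \is normalmx ->
  S = (spectralmx S) ^t* *m diag_mx (spectral_diag S) *m spectralmx S.
Proof.
by move=> /orthomx_spectralP; rewrite invmx_unitary // spectral_unitarymx.
Qed.

Lemma unitary_conjK m (P D : 'M[C]_m) : P \is unitarymx ->
  P *m (P ^t* *m D *m P) *m P ^t* = D.
Proof.
by move=> /unitarymxP Pu; rewrite !mulmxA Pu mul1mx -mulmxA Pu mulmx1.
Qed.

Lemma unitary_conjM m (P D E : 'M[C]_m) : P \is unitarymx ->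
  (P ^t* *m D *m P) *m (P ^t* *m E *m P) = P ^t* *m (D *m E) *m P.
Proof.
move=> /unitarymxP Pu; rewrite -2!mulmxA (mulmxA P) (mulmxA P) Pu mul1mx.
by rewrite !mulmxA.
Qed.

Lemma spectral_diagE m (S : 'M[C]_m) : S \is normalmx ->
  diag_mx (spectral_diag S) = spectralmx S *m S *m (spectralmx S) ^t*.
Proof.
move=> Sn; rewrite {3}(normal_spectral Sn).
by rewrite unitary_conjK ?spectral_unitarymx.
Qed.

Lemma char_poly_unitary_diag m (P : 'M[C]_m) (d : 'rV[C]_m) :
  P \is unitarymx ->
  char_poly (P ^t* *m diag_mx d *m P) = \prod_j ('X - (d 0 j)%:P).
Proof.
move=> Pu; rewrite char_poly_mulC mulmxA (unitarymxP Pu) mul1mx.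
exact: char_poly_diag.
Qed.

Lemma trace_pow_char_poly r m (S : 'M[C]_m) (s : seq C) : S \is normalmx ->
  char_poly S = \prod_(x <- s) ('X - x%:P) ->
  trace_pow r S = \sum_(x <- s) `|complex.Re x| `^ r.
Proof.
move=> Sn; rewrite {1}(normal_spectral Sn).
rewrite char_poly_unitary_diag ?spectral_unitarymx // => e.
have {}e : perm_eq [seq spectral_diag S 0 j | j <- index_enum 'I_m] s.
  by apply: prod_XsubC_eq; rewrite big_map.
by rewrite -(perm_big _ e) big_map.
Qed.

Lemma trace_pow_unitary_diag r m (P : 'M[C]_m) (d : 'rV[C]_m) :
  P \is unitarymx ->
  trace_pow r (P ^t* *m diag_mx d *m P) = \sum_j `|complex.Re (d 0 j)| `^ r.
Proof.
move=> Pu; rewrite (@trace_pow_char_poly _ _ _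
  [seq d 0 j | j <- index_enum 'I_m]).
- by rewrite big_map.
- apply/orthomx_spectral_subproof; exists (P, d) => //=.
  by rewrite invmx_unitary.
- by rewrite big_map char_poly_unitary_diag.
Qed.

Lemma eq_trace_pow r m (S T : 'M[C]_m) : S \is normalmx -> T \is normalmx ->
  char_poly S = char_poly T -> trace_pow r S = trace_pow r T.
Proof.
move=> Sn Tn e.
rewrite (@trace_pow_char_poly r _ S
  [seq spectral_diag T 0 j | j <- index_enum 'I_m]) //.
  by rewrite big_map.
rewrite e big_map {1}(normal_spectral Tn).
by rewrite char_poly_unitary_diag ?spectral_unitarymx.
Qed.

Lemma trace_powZ r m (a : R) (S : 'M[C]_m) : S \is normalmx ->
  trace_pow r (a%:C *: S) = `|a| `^ r * trace_pow r S.
Proof.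
move=> Sn; rewrite {1}(normal_spectral Sn) scalemxAl scalemxAr.
have -> : a%:C *: diag_mx (spectral_diag S) = diag_mx (a%:C *: spectral_diag S).
  by rewrite linearZ.
rewrite trace_pow_unitary_diag ?spectral_unitarymx // mulr_sumr.
by apply: eq_bigr => j _; rewrite mxE ReMl normrM powRM.
Qed.

Lemma trace_pow0 r m : r != 0 -> trace_pow r (0 : 'M[C]_m) = 0.
Proof.
move=> r0; have n0 : (0 : 'M[C]_m) \is normalmx.
  by apply: hermsymmx_normal; rewrite adjmx0.
by have := trace_powZ r 0 n0; rewrite scaler0 normr0 powR0 // mul0r.
Qed.

Lemma trace_pow_block_diag r m n (A : 'M[C]_m) (B : 'M[C]_n) :
  A ^t* = A -> B ^t* = B ->
  trace_pow r (block_mx A 0 0 B) = trace_pow r A + trace_pow r B.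
Proof.
move=> hA hB; have An := hermsymmx_normal hA; have Bn := hermsymmx_normal hB.
rewrite (@trace_pow_char_poly _ _ _
  ([seq spectral_diag A 0 j | j <- index_enum 'I_m] ++
  [seq spectral_diag B 0 j | j <- index_enum 'I_n])).
- by rewrite big_cat !big_map.
- by apply: hermsymmx_normal; rewrite adjmx_block !adjmx0 hA hB.
- rewrite char_poly_block_diag big_cat !big_map /=.
  rewrite {1}(normal_spectral An) {1}(normal_spectral Bn).
  by rewrite !char_poly_unitary_diag ?spectral_unitarymx.
Qed.

Lemma trace_pow_gramC r m (X : 'M[C]_m) :
  trace_pow r (X *m X ^t*) = trace_pow r (X ^t* *m X).
Proof.
apply: eq_trace_pow; last exact: char_poly_mulC.
- by apply: hermsymmx_normal; rewrite adjmxM trmxCK.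
- by apply: hermsymmx_normal; rewrite gram_hermitian.
Qed.

Lemma trace_pow_half_sqr p m (H : 'M[C]_m) : H ^t* = H ->
  trace_pow (p / 2) (H *m H) = trace_pow p H.
Proof.
move=> hH; have Hn := hermsymmx_normal hH.
set P := spectralmx H; set d := spectral_diag H.
have Pu : P \is unitarymx := spectral_unitarymx H.
have -> : H *m H = P ^t* *m diag_mx (\row_j (d 0 j * d 0 j)) *m P.
  have -> : H *m H = (P ^t* *m diag_mx d *m P) *m (P ^t* *m diag_mx d *m P).
    by rewrite -normal_spectral.
  rewrite (unitary_conjM _ _ Pu) mulmx_diag.
  by congr (_ *m diag_mx _ *m _); apply/rowP => j; rewrite !mxE.
rewrite trace_pow_unitary_diag //; apply: eq_bigr => j _; rewrite mxE.
have : d \is a realmx.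
  by apply: hermitian_spectral_diag_real; rewrite hermsymmxE hH.
move=> /mxOverP /(_ 0 j) e.
have -> : complex.Re (d 0 j * d 0 j) = `|complex.Re (d 0 j)| `^ 2.
  rewrite powR_mulrn // -normrX ger0_norm ?sqr_ge0 //.
  case: (d 0 j) e => a b; rewrite complex_real => /eqP -> /=.
  by rewrite mulr0 subr0 expr2.
by rewrite ger0_norm ?powR_ge0 // -powRrM mulrCA mulfV ?mulr1.
Qed.

Lemma gram_spectral_ge0 m (Y : 'M[C]_m) j :
  0 <= complex.Re (spectral_diag (Y ^t* *m Y) 0 j).
Proof.
set S := Y ^t* *m Y; set P := spectralmx S; set d := spectral_diag S.
have Pu : P \is unitarymx := spectral_unitarymx S.
have Sn : S \is normalmx by apply/hermsymmx_normal/gram_hermitian.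
have : diag_mx d = (Y *m P ^t*) ^t* *m (Y *m P ^t*).
  by rewrite adjmxM trmxCK /d spectral_diagE // !mulmxA.
move=> /matrixP /(_ j j); rewrite [LHS]mxE eqxx mulr1n => ->.
rewrite mxE raddf_sum.
apply: sumr_ge0 => k _; rewrite adjmxE mulrC mulc_conj /=.
by rewrite addr_ge0 ?sqr_ge0.
Qed.

Lemma schatten_norm_ge0 m p (Y : 'M[C]_m) : 0 <= schatten_norm p Y.
Proof. exact: powR_ge0. Qed.

Lemma schatten_normE m p (Y : 'M[C]_m) :
  schatten_norm p Y = trace_pow (p / 2) (Y ^t* *m Y) `^ p^-1.
Proof.
congr (_ `^ _); apply: eq_bigr => j _.
have Y0 := gram_spectral_ge0 Y j.
by rewrite /singular_value -powR12_sqrt // ger0_norm // -powRrM mulrC.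
Qed.

Lemma schatten_norm_hermitian m p (H : 'M[C]_m) : H ^t* = H ->
  schatten_norm p H = trace_pow p H `^ p^-1.
Proof. by move=> hH; rewrite schatten_normE hH trace_pow_half_sqr. Qed.

Lemma trace_pow_peierls r m (S U : 'M[C]_m) : 1 <= r -> S \is normalmx ->
  U \is unitarymx ->
  \sum_i `|complex.Re ((U *m S *m U ^t*) i i)| `^ r <= trace_pow r S.
Proof.
move=> r1 Sn Uu; set P := spectralmx S; set d := spectral_diag S.
have Pu : P \is unitarymx := spectral_unitarymx S.
pose V := U *m P ^t*.
have Ptu : P ^t* \is unitarymx by rewrite trmxC_unitary.
have Vu : V \is unitarymx := mul_unitarymx Uu Ptu.
pose q i j := complex.Re (V i j) ^+ 2 + complex.Im (V i j) ^+ 2.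
have q0 i j : 0 <= q i j by rewrite addr_ge0 ?sqr_ge0.
have qE i j : (q i j)%:C = V i j * (V i j)^*%R by rewrite mulc_conj.
have complexI : injective (real_complex R) by move=> x y [].
have qrow i : \sum_j q i j = 1.
  apply: complexI; rewrite rmorph_sum rmorph1 /=.
  have /matrixP/(_ i i) := unitarymxP Vu; rewrite !mxE eqxx mulr1n => <-.
  by apply: eq_bigr => j _; rewrite qE adjmxE.
have qcol j : \sum_i q i j = 1.
  apply: complexI; rewrite rmorph_sum rmorph1 /=.
  have : V ^t* \is unitarymx by rewrite trmxC_unitary.
  move=> /unitarymxP /matrixP/(_ j j); rewrite trmxCK !mxE eqxx mulr1n => <-.
  by apply: eq_bigr => i _; rewrite qE adjmxE mulrC.
have dE i :
    complex.Re ((U *m S *m U ^t*) i i) = \sum_j q i j * complex.Re (d 0 j).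
  have -> : U *m S *m U ^t* = V *m diag_mx d *m V ^t*.
    by rewrite {1}(normal_spectral Sn) adjmxM trmxCK !mulmxA.
  rewrite mxE raddf_sum /=; apply: eq_bigr => j _.
  rewrite -ReMl qE adjmxE mul_mx_diag mxE; congr complex.Re; ring.
apply: (@le_trans _ _ (\sum_i \sum_j q i j * `|complex.Re (d 0 j)| `^ r)).
  apply: ler_sum => i _; rewrite dE.
  apply: le_trans (powR_jensen r1 (q0 i) (qrow i) (fun j => normr_ge0 _)).
  apply: ge0_ler_powR; rewrite ?nnegrE ?(le_trans _ r1) //.
    by apply: sumr_ge0 => j _; rewrite mulr_ge0.
  apply: le_trans (ler_norm_sum _ _ _) _.
  by apply: ler_sum => j _; rewrite normrM ger0_norm.
rewrite exchange_big /=; apply: ler_sum => j _.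
by rewrite -mulr_suml qcol mul1r.
Qed.

Lemma trace_powD_le r m (S T : 'M[C]_m) : 1 <= r -> S ^t* = S -> T ^t* = T ->
  trace_pow r (S + T) <= 2 `^ (r - 1) * (trace_pow r S + trace_pow r T).
Proof.
move=> r1 hS hT.
have STn : S + T \is normalmx by apply: hermsymmx_normal; rewrite adjmxD hS hT.
set P := spectralmx (S + T).
have Pu : P \is unitarymx := spectral_unitarymx _.
have dE : diag_mx (spectral_diag (S + T)) = P *m S *m P ^t* + P *m T *m P ^t*.
  by rewrite -mulmxDl -mulmxDr (spectral_diagE STn).
have hS' := trace_pow_peierls r1 (hermsymmx_normal hS) Pu.
have hT' := trace_pow_peierls r1 (hermsymmx_normal hT) Pu.
apply: le_trans (ler_wpM2l (powR_ge0 _ _) (lerD hS' hT')).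
rewrite -big_split /= mulr_sumr; apply: ler_sum => j _.
have -> : spectral_diag (S + T) 0 j =
    (P *m S *m P ^t*) j j + (P *m T *m P ^t*) j j.
  by have /matrixP/(_ j j) := dE; rewrite [LHS]mxE eqxx mulr1n => ->; rewrite mxE.
by rewrite raddfD /= powR_normD.
Qed.

End TracePow.

Section NumericalRadius.
Local Open Scope sesquilinear_scope.
Local Open Scope complex_scope.
Variable R : realType.
Local Notation C := R[i].
Implicit Types p theta : R.

Lemma half_conj : (2^-1 : C)^*%R = 2^-1.
Proof. by rewrite fmorphV rmorph_nat. Qed.

Lemma expi_conj theta : expi theta * (expi theta)^*%R = 1.
Proof. by rewrite mulc_conj /= cos2Dsin2. Qed.

Lemma re_mx_hermitian m (Z : 'M[C]_m) : (re_mx Z) ^t* = re_mx Z.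
Proof. by rewrite /re_mx adjmxZ half_conj adjmxD trmxCK addrC. Qed.

Lemma re_mxD m (Y Z : 'M[C]_m) : re_mx (Y + Z) = re_mx Y + re_mx Z.
Proof. by rewrite /re_mx adjmxD -scalerDr addrACA. Qed.

Lemma re_mxZ m (a : R) (Z : 'M[C]_m) : re_mx (a%:C *: Z) = a%:C *: re_mx Z.
Proof.
by rewrite /re_mx adjmxZ conj_real_complex -scalerDr !scalerA mulrC.
Qed.

Lemma re_mx_id m (H : 'M[C]_m) : H ^t* = H -> re_mx H = H.
Proof.
have half2 : 2^-1 + 2^-1 = 1 :> C by field.
by move=> hH; rewrite /re_mx hH scalerDr -scalerDl half2 scale1r.
Qed.

Lemma expi_split theta : expi theta = (cos theta)%:C + (sin theta)%:C * 'i.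
Proof. by rewrite [LHS]complexE mulrC. Qed.

Lemma re_mx_expi m theta (Y : 'M[C]_m) :
  re_mx (expi theta *: Y) =
  (cos theta)%:C *: re_mx Y + (sin theta)%:C *: re_mx ('i *: Y).
Proof. by rewrite expi_split scalerDl -scalerA re_mxD !re_mxZ. Qed.

Lemma re_mx_expi_hermitian m theta (H : 'M[C]_m) : H ^t* = H ->
  re_mx (expi theta *: H) = (cos theta)%:C *: H.
Proof.
move=> hH; rewrite re_mx_expi re_mx_id //.
rewrite [X in _ + _ *: X](_ : _ = 0) ?scaler0 ?addr0 //.
have conj_i : ('i)^*%R = - 'i :> C by congr (_ +i* _); rewrite oppr0.
by rewrite /re_mx adjmxZ hH conj_i scaleNr subrr scaler0.
Qed.

Lemma trace_pow_re_mx_bound m p theta (Y : 'M[C]_m) : 1 <= p ->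
  trace_pow p (re_mx (expi theta *: Y)) <=
  2 `^ (p - 1) * (trace_pow p (re_mx Y) + trace_pow p (re_mx ('i *: Y))).
Proof.
move=> p1; have p0 : 0 <= p by rewrite (le_trans _ p1).
have hZ (a : R) Z : (a%:C *: re_mx Z) ^t* = a%:C *: re_mx Z :> 'M[C]_m.
  by rewrite adjmxZ conj_real_complex re_mx_hermitian.
rewrite re_mx_expi.
apply: (le_trans (trace_powD_le p1 (hZ _ _) (hZ _ _))).
have hn (Z : 'M[C]_m) : re_mx Z \is normalmx.
  exact/hermsymmx_normal/re_mx_hermitian.
apply: ler_wpM2l; first exact: powR_ge0.
rewrite (trace_powZ _ _ (hn Y)) (trace_powZ _ _ (hn ('i *: Y))).
apply: lerD; rewrite ler_piMl ?trace_pow_ge0 // norm_powR_le1 //.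
  by rewrite ler_norml cos_geN1 cos_le1.
by rewrite ler_norml sin_geN1 sin_le1.
Qed.

Lemma schatten_norm_re_mx m p (Z : 'M[C]_m) :
  schatten_norm p (re_mx Z) = trace_pow p (re_mx Z) `^ p^-1.
Proof. exact/schatten_norm_hermitian/re_mx_hermitian. Qed.

Lemma schatten_numrad_le m p (Y : 'M[C]_m) (c : R) : 1 <= p ->
  (forall theta, trace_pow p (re_mx (expi theta *: Y)) <= c) ->
  schatten_numrad p Y <= c `^ p^-1.
Proof.
move=> p1 hc; apply: ge_sup.
  by exists (schatten_norm p (re_mx (expi 0 *: Y))); exists 0.
move=> _ [theta _ <-]; rewrite schatten_norm_re_mx.
apply: ge0_ler_powR; rewrite ?invr_ge0 ?(le_trans _ p1) // ?nnegrE ?trace_pow_ge0 //.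
exact: le_trans (trace_pow_ge0 _ _) (hc 0).
Qed.

Lemma schatten_norm_le_numrad m p theta (Y : 'M[C]_m) : 1 <= p ->
  schatten_norm p (re_mx (expi theta *: Y)) <= schatten_numrad p Y.
Proof.
move=> p1; have p0 : 0 < p by rewrite (lt_le_trans _ p1).
apply: ub_le_sup; last by exists theta.
exists ((2 `^ (p - 1) *
  (trace_pow p (re_mx Y) + trace_pow p (re_mx ('i *: Y)))) `^ p^-1).
move=> _ [t _ <-]; rewrite schatten_norm_re_mx; apply: ge0_ler_powR.
- by rewrite invr_ge0 ltW.
- by rewrite nnegrE trace_pow_ge0.
- by rewrite nnegrE mulr_ge0 ?powR_ge0 // addr_ge0 ?trace_pow_ge0.
- exact: trace_pow_re_mx_bound.
Qed.

Lemma schatten_numrad_ge0 m p (Y : 'M[C]_m) :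
  1 <= p -> 0 <= schatten_numrad p Y.
Proof.
move=> p1; apply: le_trans (schatten_norm_le_numrad 0 Y p1).
exact: schatten_norm_ge0.
Qed.

Lemma trace_pow_le_schatten_numrad m p theta (Y : 'M[C]_m) : 1 <= p ->
  trace_pow p (re_mx (expi theta *: Y)) <= schatten_numrad p Y `^ p.
Proof.
move=> p1; have p0 : 0 < p by rewrite (lt_le_trans _ p1).
rewrite -[leLHS](@powRVK _ p) ?gt_eqF ?trace_pow_ge0 // -schatten_norm_re_mx.
apply: ge0_ler_powR; first exact: ltW.
- by rewrite nnegrE schatten_norm_ge0.
- by rewrite nnegrE schatten_numrad_ge0.
- exact: schatten_norm_le_numrad.
Qed.

Lemma schatten_numrad_hermitian m p (H : 'M[C]_m) : 1 <= p -> H ^t* = H ->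
  schatten_numrad p H = trace_pow p H `^ p^-1.
Proof.
move=> p1 hH; have p0 : 0 < p by rewrite (lt_le_trans _ p1).
apply: le_anti; apply/andP; split.
  apply: schatten_numrad_le => // theta; rewrite re_mx_expi_hermitian //.
  rewrite trace_powZ; last exact: hermsymmx_normal.
  rewrite ler_piMl ?trace_pow_ge0 // (norm_powR_le1 (ltW p0)) //.
  by rewrite ler_norml cos_geN1 cos_le1.
have := trace_pow_le_schatten_numrad 0 H p1.
rewrite re_mx_expi_hermitian // cos0 scale1r => h.
rewrite -[leRHS](@powRKV _ p) ?gt_eqF ?schatten_numrad_ge0 //.
apply: ge0_ler_powR; rewrite ?nnegrE ?trace_pow_ge0 ?powR_ge0 ?invr_ge0 //.
exact: ltW.
Qed.

Lemma re_mx_block_diag n (A D : 'M[C]_n) (c : C) :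
  re_mx (c *: block_mx A 0 0 D) = block_mx (re_mx (c *: A)) 0 0 (re_mx (c *: D)).
Proof.
rewrite /re_mx scale_block_mx !scaler0 adjmx_block !adjmx0 add_block_mx !addr0.
by rewrite scale_block_mx !scaler0.
Qed.

Lemma re_mx_block_row n (A B : 'M[C]_n) (c : C) (K := (2^-1 * c) *: B) :
  re_mx (c *: block_mx A B 0 0) = block_mx (re_mx (c *: A)) K (K ^t*) 0.
Proof.
rewrite /re_mx scale_block_mx !scaler0 adjmx_block !adjmx0 add_block_mx !addr0 !add0r.
by rewrite scale_block_mx !scaler0 /K -scalerA (adjmxZ 2^-1) half_conj.
Qed.

Lemma schatten_numrad_block_diag_le n p (A D : 'M[C]_n) : 1 <= p ->
  schatten_numrad p (block_mx A 0 0 D) <=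
  (schatten_numrad p A `^ p + schatten_numrad p D `^ p) `^ p^-1.
Proof.
move=> p1; apply: schatten_numrad_le => // theta.
rewrite re_mx_block_diag trace_pow_block_diag ?re_mx_hermitian //.
by apply: lerD; exact: trace_pow_le_schatten_numrad.
Qed.

(* Writing [M = X1 + X2] with [X1], [X2] the first and second block columns,
   [M M^* = X1 X1^* + X2 X2^*], while [X1^* X1] and [X2^* X2] live on the
   diagonal blocks; convexity of [x ^ (p / 2)] is then used twice. *)
Lemma trace_pow_block_hermitian_le n p (H K : 'M[C]_n) : 2 <= p -> H ^t* = H ->
  trace_pow p (block_mx H K (K ^t*) 0) <=
  2 `^ (p - 2) * (trace_pow p H + 2 * trace_pow (p / 2) (K ^t* *m K)).
Proof.
move=> p2 hH; set M := block_mx _ _ _ _; set r := p / 2.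
have r1 : 1 <= r by rewrite /r ler_pdivlMr // mul1r.
have rn0 : r != 0 by rewrite gt_eqF // (lt_le_trans _ r1).
have hM : M ^t* = M by rewrite /M adjmx_block trmxCK hH adjmx0.
pose X1 : 'M[C]_(n + n) := block_mx H 0 (K ^t*) 0.
pose X2 : 'M[C]_(n + n) := block_mx 0 K 0 0.
have MM : M *m M = X1 *m X1 ^t* + X2 *m X2 ^t*.
  rewrite -{2}hM /M /X1 /X2 !adjmx_block !mulmx_block !adjmx0 !mulmx0 !mul0mx.
  by rewrite !addr0 !add0r add_block_mx !addr0.
have X1E : X1 ^t* *m X1 = block_mx (H *m H + K *m K ^t*) 0 0 0.
  rewrite /X1 adjmx_block mulmx_block !adjmx0 !mulmx0 !mul0mx !addr0.
  by rewrite trmxCK hH.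
have X2E : X2 ^t* *m X2 = block_mx 0 0 0 (K ^t* *m K).
  by rewrite /X2 adjmx_block mulmx_block !adjmx0 !mulmx0 !mul0mx !addr0.
have hHH : (H *m H) ^t* = H *m H by rewrite adjmxM hH.
have hKK : (K *m K ^t*) ^t* = K *m K ^t* by rewrite adjmxM trmxCK.
have hX (X : 'M[C]_(n + n)) : (X *m X ^t*) ^t* = X *m X ^t*.
  by rewrite adjmxM trmxCK.
have hKK' := gram_hermitian K.
have step1 := trace_powD_le r1 (hX X1) (hX X2).
have step2 := trace_powD_le r1 hHH hKK.
rewrite -MM !trace_pow_gramC X1E X2E in step1.
rewrite !trace_pow_block_diag ?adjmx0 ?adjmxD ?hHH ?hKK // in step1.
rewrite !trace_pow0 // add0r addr0 !trace_pow_half_sqr // in step1.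
rewrite trace_pow_half_sqr // trace_pow_gramC in step2.
have -> : 2 `^ (p - 2) = 2 `^ (r - 1) * 2 `^ (r - 1) :> R.
  have -> : p - 2 = (r - 1) + (r - 1) by rewrite /r; lra.
  by rewrite powRD //; apply/implyP.
apply: (le_trans step1); rewrite -mulrA ler_wpM2l ?powR_ge0 //.
apply: (le_trans (lerD step2 (lexx _))).
have c1 : 1 <= 2 `^ (r - 1) :> R.
  by rewrite -[leLHS](powRr0 2) ler_powR ?subr_ge0 // ler1n.
have := ler_wpM2r (trace_pow_ge0 r (K ^t* *m K)) c1.
by rewrite mul1r; lra.
Qed.

Lemma trace_pow_gramZ n p (c : C) (B : 'M[C]_n) (K := (2^-1 * c) *: B) :
  c * c^*%R = 1 ->
  trace_pow (p / 2) (K ^t* *m K) = 2 `^ (- p) * trace_pow (p / 2) (B ^t* *m B).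
Proof.
move=> hc.
have k2 : (2^-1 * c)^*%R * (2^-1 * c) = (4^-1)%:C.
  rewrite [(_ * c)^*%R]rmorphM /= half_conj.
  transitivity (2^-1 * 2^-1 * (c * c^*%R)); first by ring.
  by rewrite hc mulr1 -invfM -natrM fmorphV rmorph_nat.
have -> : K ^t* *m K = (4^-1)%:C *: (B ^t* *m B).
  by rewrite /K adjmxZ -scalemxAl -scalemxAr scalerA k2.
rewrite trace_powZ; last exact/hermsymmx_normal/gram_hermitian.
congr (_ * _); rewrite ger0_norm ?invr_ge0 //.
have -> : 4^-1 = 2 `^ (- 2%:R) :> R by rewrite powR_invn // -natrX.
by rewrite -powRrM; congr (_ `^ _); field.
Qed.

Lemma schatten_numrad_block_diag_hermitian n p (A D : 'M[C]_n) : 1 <= p ->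
  A ^t* = A -> D ^t* = D ->
  schatten_numrad p (block_mx A 0 0 D) =
  (schatten_numrad p A `^ p + schatten_numrad p D `^ p) `^ p^-1.
Proof.
move=> p1 hA hD; have pn0 : p != 0 by rewrite gt_eqF // (lt_le_trans _ p1).
have hAD : (block_mx A 0 0 D) ^t* = block_mx A 0 0 D.
  by rewrite adjmx_block !adjmx0 hA hD.
rewrite (schatten_numrad_hermitian p1 hA) (schatten_numrad_hermitian p1 hD).
rewrite (schatten_numrad_hermitian p1 hAD) trace_pow_block_diag //.
congr (_ `^ _); congr (_ + _); apply/esym; apply: (powRVK pn0).
  exact: trace_pow_ge0.
exact: trace_pow_ge0.
Qed.

Lemma schatten_numrad_block_row_le n p (A B : 'M[C]_n) : 2 <= p ->
  schatten_numrad p (block_mx A B 0 0) <=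
  (2 `^ (p - 2) * (schatten_numrad p A `^ p +
                   (2 `^ (p - 1))^-1 * schatten_norm p B `^ p)) `^ p^-1.
Proof.
move=> p2; have p1 : 1 <= p by lra.
have pn0 : p != 0 by rewrite gt_eqF // (lt_le_trans _ p1).
apply: schatten_numrad_le => // theta; rewrite re_mx_block_row.
apply: le_trans (trace_pow_block_hermitian_le _ p2 (re_mx_hermitian _)) _.
rewrite ler_wpM2l ?powR_ge0 // trace_pow_gramZ ?expi_conj //.
apply: lerD; first exact: trace_pow_le_schatten_numrad.
rewrite schatten_normE powRVK ?trace_pow_ge0 // mulrA -powRN opprB.
rewrite powRD ?powRr1 //; exact/implyP.
Qed.

End NumericalRadius.

Theorem mainTheorem9 (R : realType) (p : R) (n : nat) (A B D : 'M[R[i]]_n)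
    (hp : 2 <= p) :
  (schatten_numrad p (block_mx A 0 0 D)
     <= 1 / 2 `^ (2 / p - 1) *
        (schatten_numrad p A `^ p + schatten_numrad p D `^ p) `^ (1 / p)
   /\
   (A \is hermsymmx -> D \is hermsymmx ->
    schatten_numrad p (block_mx A 0 0 D) =
      (schatten_numrad p A `^ p + schatten_numrad p D `^ p) `^ (1 / p)))
  /\
  schatten_numrad p (block_mx A B 0 0)
    <= 1 / 2 `^ (2 / p - 1) *
       (schatten_numrad p A `^ p
          + 1 / 2 `^ (p - 1) * schatten_norm p B `^ p) `^ (1 / p).
Proof.
have p1 : 1 <= p by lra.
have p0 : 0 < p by lra.
have pn0 : p != 0 by rewrite gt_eqF.
have cE : 1 / 2 `^ (2 / p - 1) = (2 `^ (p - 2)) `^ p^-1 :> R.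
  by rewrite div1r -powRN -powRrM; congr (_ `^ _); field.
rewrite !div1r -[(2 `^ (2 / p - 1))^-1]div1r cE.
have c1 : 1 <= (2 `^ (p - 2)) `^ p^-1 :> R.
  rewrite -powRrM -[leLHS](powRr0 2) ler_powR ?ler1n // mulr_ge0 ?subr_ge0 //.
  by rewrite invr_ge0 ltW.
split; [split|].
- apply: le_trans (schatten_numrad_block_diag_le A D p1) _.
  by rewrite ler_peMl ?powR_ge0.
- rewrite !hermsymmxE => /eqP hA /eqP hD.
  exact: schatten_numrad_block_diag_hermitian.
rewrite -powRM ?powR_ge0 ?addr_ge0 ?mulr_ge0 ?invr_ge0 ?powR_ge0 //.
exact: schatten_numrad_block_row_le.
Qed.
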